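(* Let $G$ be a countable discrete amenable group, $X=\mathbb{N}^G$, let $\phi\colon X\to\mathbb{R}$ be a potential and let $A\subseteq\mathbb{N}$ be a nonempty finite set such that the restriction of $\phi$ to $A^G$ is non-negative. Then, for every $E\subseteq G$, every $u_E\in A^E$, every $F\in\mathcal{F}(G)$, every integer $k\geq 1$ and every $k$-cover $\mathcal{K}$ of $F$, it holds that $$Z^{u_E}_F\leq\prod_{K\in\mathcal{K}}\left(Z^{u_E}_K\right)^{1/k}.$$ In particular, the function $\varphi\colon F\mapsto\log Z_F(A,\phi)$ on $\mathcal{F}(G)$ satisfies Shearer's inequality: for every $F\in\mathcal{F}(G)$ and every $k$-cover $\mathcal{K}$ of $F$, $\varphi(F)\leq\frac1k\sum_{K\in\mathcal{K}}\varphi(K)$.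
   Context: $\mathbb{N}$ is the set of non-negative integers. $\mathcal{F}(G)$ is the set of nonempty finite subsets of $G$. $G$ acts on $X$ by $(g\cdot x)(h)=x(hg)$, and $\phi_F(x)=\sum_{g\in F}\phi(g\cdot x)$ for $F\in\mathcal{F}(G)$. For $D\subseteq G$ and $v\in\mathbb{N}^D$, $[v]=\{x\in X:x_D=v\}$, where $x_D$ is the restriction of $x$ to $D$. For $E\subseteq G$ (possibly empty or infinite), $u_E\in A^E$ and $F\in\mathcal{F}(G)$, define $$Z_F^{u_E}=\sum_{w\in A^{F\setminus E}}\exp\left(\sup\{\phi_F(x): x\in A^G,\ x_{F\setminus E}=w,\ x_E=u_E\}\right),$$ and $Z_F(A,\phi)=Z_F^{u_\emptyset}$, i.e. $Z_F(A,\phi)=\sum_{w\in A^F}\exp(\sup\phi_F([w]\cap A^G))$. Under the hypothesis that $\phi|_{A^G}\ge 0$ these quantities take values in $[1,+\infty]$. A $k$-cover of $F\in\mathcal{F}(G)$ is a finite family $\mathcal{K}=\{K_1,\dots,K_r\}$ of elements of $\mathcal{F}(G)$ (repetitions allowed, and the $K_i$ need not be subsets of $F$) such that each element of $F$ belongs to $K_i$ for at least $k$ indices $i$. Products and sums over $K\in\mathcal{K}$ are taken with multiplicity. *)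

(* Defs.v *)
From HB Require Import structures.
From mathcomp Require Import all_boot all_order all_algebra finmap.
From mathcomp Require Import all_classical all_reals all_analysis.

Set Implicit Arguments.
Unset Strict Implicit.
Unset Printing Implicit Defensive.

Import Order.TTheory GRing.Theory Num.Theory.
Import numFieldNormedType.Exports.

Local Open Scope classical_set_scope.
Local Open Scope ring_scope.

(* Existence of a right Følner sequence for a countable discrete group: the
   side matches the shift action below, since
   birkhoff phi F (shift g x) = birkhoff phi (rtranslate F g) x. *)
Definition rtranslate (G : groupType) (F : {fset G}) (g : G) : {fset G} :=
  [fset (h * g)%g | h in F]%fset.

Definition fsymdiff (T : choiceType) (A B : {fset T}) : {fset T} :=
  ((A `\` B) `|` (B `\` A))%fset.

Definition amenable (R : realType) (G : groupType) : Prop :=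
  exists Fn : nat -> {fset G},
    (forall n, Fn n != fset0) /\
    (forall g : G,
       (fun n => #|` fsymdiff (rtranslate (Fn n) g) (Fn n)|%:R
                 / #|` Fn n|%:R : R) @ \oo --> (0 : R)).

Definition shift (G : groupType) (g : G) (x : G -> nat) : G -> nat :=
  fun h => x (h * g)%g.

Definition birkhoff (R : realType) (G : groupType) (phi : (G -> nat) -> R)
    (F : {fset G}) (x : G -> nat) : R :=
  \sum_(g <- F) phi (shift g x).

Definition full_shift (G : groupType) (A : {fset nat}) : set (G -> nat) :=
  [set x | forall g, x g \in A].

Definition fset_diff_set (T : choiceType) (F : {fset T}) (E : set T) :
    {fset T} :=
  [fset g in F | g \notin E]%fset.

(* [E] is coerced to the type of its elements, so that [u] is an element of
   A^E, and [w] ranges over A^(F \ E).  The supremum is taken in \bar R, hence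
   Z is extended-real valued. *)
Definition Zu (R : realType) (G : groupType) (A : {fset nat})
    (phi : (G -> nat) -> R) (E : set G) (u : E -> A) (F : {fset G}) : \bar R :=
  (\sum_(w : {ffun fset_diff_set F E -> A})
     expeR (ereal_sup [set (birkhoff phi F x)%:E | x in
       [set x | [/\ full_shift A x,
                    forall h : fset_diff_set F E, x (val h) = val (w h) &
                    forall g : E, x (val g) = val (u g)]]]))%E.

Definition u_empty (G : Type) (A : {fset nat}) : (set0 : set G) -> A :=
  fun g => False_rect A (set_mem (valP g)).

Definition Z (R : realType) (G : groupType) (A : {fset nat})
    (phi : (G -> nat) -> R) (F : {fset G}) : \bar R :=
  Zu phi (@u_empty G A) F.

Definition cylinder (G : groupType) (A : {fset nat}) (F : {fset G})
    (w : {ffun F -> A}) : set (G -> nat) :=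
  [set x | forall h : F, x (val h) = val (w h)].

Lemma ZE (R : realType) (G : groupType) (A : {fset nat})
    (phi : (G -> nat) -> R) (F : {fset G}) :
  Z A phi F =
  (\sum_(w : {ffun F -> A})
     expeR (ereal_sup
       [set (birkhoff phi F x)%:E | x in cylinder w `&` full_shift A]))%E.
Proof.
have eqF : fset_diff_set F set0 = F.
  by apply/fsetP => g; rewrite !inE /= in_set0 andbT.
rewrite /Z /Zu; move: (birkhoff phi F) => b.
move: (fset_diff_set F set0) eqF => D eqD; subst D.
apply: eq_bigr => w _; congr (expeR (ereal_sup _)).
congr image; apply/seteqP; split => x /=; first by case.
by case=> xw xA; split => // g; case: (set_mem (valP g)).
Qed.

(* Multiplicities are allowed in a cover, hence a sequence of finite sets. *)
Definition kcover (G : groupType) (k : nat) (F : {fset G})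
    (K : seq {fset G}) : Prop :=
  (forall L, L \in K -> L != fset0) /\
  (forall g, g \in F -> (k <= count (fun L : {fset G} => g \in L) K)%N).

Definition shearer (R : realType) (G : groupType) (f : {fset G} -> \bar R) :
    Prop :=
  forall (F : {fset G}) (k : nat) (K : seq {fset G}),
    F != fset0 -> (1 <= k)%N -> kcover k F K ->
    (f F <= (k%:R^-1)%:E * \sum_(L <- K) f L)%E.

(* Main.v *)
(* Since phi >= 0 on A^G, k phi_F <= \sum_L phi_L for a k-cover.  Hence, with
   D = F \ E and f_L(v) = exp (sup phi_L over the x in A^G that agree with v on
   D :&: L and with u on E), each term of Z_F is at most the corresponding
   product of the f_L^(1/k), and the discrete Finner (Loomis-Whitney) inequality
   bounds the sum of these products over A^D by the product of the
   (\sum_v f_L(v))^(1/k).  Finally \sum_v f_L(v) <= Z_L, because the exponential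
   of a supremum over a block of cylinders is at most the sum of the
   exponentials of the suprema over the cylinders. *)
Require Import Defs.
From HB Require Import structures.
From mathcomp Require Import all_boot all_order all_algebra finmap.
From mathcomp Require Import all_classical all_reals all_analysis.

Set Implicit Arguments.
Unset Strict Implicit.
Unset Printing Implicit Defensive.

Import Order.TTheory GRing.Theory Num.Theory.
Import numFieldNormedType.Exports.

Local Open Scope classical_set_scope.
Local Open Scope ring_scope.

(** * Hölder's inequality for finite sums, from AM-GM *)

Lemma prod_powR_AGM (R : realType) (T : Type) (K : seq T) (x : T -> R) :
  (0 < size K)%N -> (forall L, 0 <= x L) ->
  \prod_(L <- K) x L `^ (size K)%:R^-1 <= (\sum_(L <- K) x L) / (size K)%:R.
Proof.
move=> K_gt0 x_ge0; set m := size K.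
have m_neq0 : m%:R != 0 :> R by rewrite pnatr_eq0 -lt0n.
rewrite -(@ler_pXn2r _ m) //; last 2 first.
- by rewrite nnegrE prodr_ge0 // => L _; exact: powR_ge0.
- by rewrite nnegrE divr_ge0 // sumr_ge0.
rewrite -prodrXl.
under eq_bigr do rewrite -powR_mulrn ?powR_ge0 // -powRrM mulVf // powRr1 //.
have [+ _] := leif_AGM (A := 'I_m) (E := fun i => x (tnth (in_tuple K) i))
  (fun i _ => x_ge0 _).
by rewrite card_ord !(big_tnth _ _ K).
Qed.

(* After normalizing each [g L] to have sum 1, its values lie in [0, 1], so the
   exponent 1/k may be lowered to 1/(size K), where AM-GM applies. *)
Lemma holder_count (R : realType) (T I : eqType) (K : seq T) (s : seq I)
    (k : nat) (g : T -> I -> R) :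
  (0 < k <= size K)%N -> (forall L a, 0 <= g L a) ->
  \sum_(a <- s) \prod_(L <- K) g L a `^ k%:R^-1 <=
  \prod_(L <- K) (\sum_(a <- s) g L a) `^ k%:R^-1.
Proof.
move=> /andP[k_gt0 k_le] g_ge0; pose t L := \sum_(a <- s) g L a.
have t_ge0 L : 0 <= t L by exact: sumr_ge0.
have k_neq0 : k%:R^-1 != 0 :> R by rewrite invr_eq0 pnatr_eq0 -lt0n.
have K_gt0 : (0 < size K)%N by exact: leq_trans k_le.
have g_le_t L a : a \in s -> g L a <= t L.
  by move=> a_s; rewrite /t (big_rem a a_s) /= lerDl sumr_ge0.
(* A zero total cannot be normalized, but then [g L0] vanishes on [s] and every product on the left
   is 0. *)
have [/hasP[L0 L0K /eqP tL0]|/hasPn t_neq0] := boolP (has (fun L => t L == 0) K).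
  rewrite [leLHS]big_seq big1 => [|a a_s].
    by rewrite prodr_ge0 // => L _; exact: powR_ge0.
  have gL0 : g L0 a = 0.
    by apply/eqP; rewrite eq_le g_ge0 andbT -tL0 g_le_t.
  by rewrite (big_rem L0 L0K) /= gL0 powR0 // mul0r.
pose p L a := g L a / t L.
have p_ge0 L a : 0 <= p L a by rewrite divr_ge0.
have gE L a : L \in K -> g L a = p L a * t L.
  by move=> /t_neq0 tL; rewrite /p divfK.
have -> : \sum_(a <- s) \prod_(L <- K) g L a `^ k%:R^-1 =
    (\sum_(a <- s) \prod_(L <- K) p L a `^ k%:R^-1) *
    \prod_(L <- K) t L `^ k%:R^-1.
  rewrite big_distrl /=; apply: eq_bigr => a _; rewrite -big_split /=.
  by apply: eq_big_seq => L LK; rewrite gE // powRM.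
apply: ler_piMl; first by rewrite prodr_ge0 // => L _; exact: powR_ge0.
have m_neq0 : (size K)%:R != 0 :> R by rewrite pnatr_eq0 -lt0n.
apply: (@le_trans _ _ (\sum_(a <- s) (\sum_(L <- K) p L a) / (size K)%:R)).
  rewrite [leLHS]big_seq [leRHS]big_seq; apply: ler_sum => a a_s.
  apply: le_trans (prod_powR_AGM K_gt0 (p_ge0 ^~ a)).
  rewrite [leLHS]big_seq [leRHS]big_seq; apply: ler_prod => L LK.
  rewrite powR_ge0 /=; have := p_ge0 L a; rewrite le_eqVlt => /predU1P[<-|p_gt0].
    by rewrite !powR0 // invr_eq0.
  apply: ger_powR.
    rewrite p_gt0 ler_pdivrMr ?mul1r ?g_le_t //.
    by rewrite lt_neqAle eq_sym t_neq0 //=.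
  by rewrite lef_pV2 ?posrE ?ltr0n // ler_nat.
(* After swapping the sums, each normalized [p L] contributes 1, so the total is [size K]. *)
rewrite -mulr_suml exchange_big /= ler_pdivrMr ?ltr0n // mul1r.
rewrite big_seq (eq_bigr (fun=> 1)) => [|L LK].
  by rewrite -big_seq big_const_seq count_predT iter_addr_0.
by rewrite -mulr_suml divff ?t_neq0.
Qed.

(** * Finner's inequality, one coordinate at a time *)

Section coordinates.
Context {G : eqType} {V : Type}.

Definition update (x : G -> V) (g : G) (a : V) : G -> V :=
  fun h => if h == g then a else x h.

(** Total functions are listed, rather than finite functions on [s], so that a coordinate can be
    peeled off by induction and different coordinate sets share one type. *)
Fixpoint updates (A : seq V) (s : seq G) (x : G -> V) : seq (G -> V) :=
  if s is g :: s' then [seq update y g a | a <- A, y <- updates A s' x]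
  else [:: x].

Lemma big_updates_cons (R : pzSemiRingType) A g s x (f : (G -> V) -> R) :
  \sum_(y <- updates A (g :: s) x) f y =
  \sum_(a <- A) \sum_(y <- updates A s x) f (update y g a).
Proof. by rewrite big_allpairs_dep. Qed.

End coordinates.

Definition depends_on (G U V : Type) (P : pred G) (f : (G -> V) -> U) : Prop :=
  forall x y, (forall g, P g -> x g = y g) -> f x = f y.

Lemma depends_on_update (G : eqType) (U V : Type) (P : pred G)
    (f : (G -> V) -> U) (g : G) (a : V) :
  depends_on P f -> depends_on P (fun y => f (update y g a)).
Proof.
move=> f_dep x y xy; apply: f_dep => h Ph; rewrite /update.
by case: ifP => // _; exact: xy.
Qed.

(* Induction on the coordinates: [holder_count] is applied to the factors that
   depend on the first coordinate, the other ones being constant in it. *)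
Lemma finner (R : realType) (G T V : eqType) (A : seq V) (K : seq T) (k : nat)
    (P : T -> pred G) (f : T -> (G -> V) -> R) (s : seq G) (x : G -> V) :
  (0 < k)%N -> (forall L y, 0 <= f L y) ->
  (forall L, depends_on (P L) (f L)) ->
  (forall g, g \in s -> (k <= count (P ^~ g) K)%N) ->
  \sum_(y <- updates A s x) \prod_(L <- K) f L y `^ k%:R^-1 <=
  \prod_(L <- K) (\sum_(y <- updates A [seq g <- s | P L g] x) f L y) `^ k%:R^-1.
Proof.
move=> k_gt0; elim: s f => [|g s IH] f f_ge0 f_dep s_cov.
  by rewrite big_seq1 ler_prod // => L _; rewrite big_seq1 lexx powR_ge0.
rewrite big_updates_cons.
pose h L a := \sum_(y <- updates A [seq g <- s | P L g] x) f L (update y g a).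
have h_ge0 L a : 0 <= h L a by exact: sumr_ge0.
apply: (@le_trans _ _ (\sum_(a <- A) \prod_(L <- K) h L a `^ k%:R^-1)).
  apply: ler_sum => a _; apply: (IH (fun L y => f L (update y g a))) => //.
    by move=> L; exact: depends_on_update.
  by move=> g' g's; rewrite s_cov // inE g's orbT.
rewrite [leRHS](bigID (P ^~ g)) /=.
have h_off L a : ~~ P L g ->
    h L a = \sum_(y <- updates A [seq g <- g :: s | P L g] x) f L y.
  move=> /negPf /= Lg; rewrite Lg; apply: eq_bigr => y _.
  apply: f_dep => g' Pg'; rewrite /update; case: eqP => // g'g.
  by rewrite g'g Lg in Pg'.
rewrite (eq_bigr (fun a => (\prod_(L <- K | P L g) h L a `^ k%:R^-1) *
    \prod_(L <- K | ~~ P L g)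
      (\sum_(y <- updates A [seq g <- g :: s | P L g] x) f L y) `^ k%:R^-1));
  last first.
  move=> a _; rewrite (bigID (fun L => P L g)) /=; congr (_ * _).
  by apply: eq_bigr => L Lg; rewrite h_off.
rewrite -mulr_suml; apply: ler_wpM2r.
  by rewrite prodr_ge0 // => L _; exact: powR_ge0.
rewrite (eq_bigr (fun a => \prod_(L <- [seq L <- K | P L g]) h L a `^ k%:R^-1));
  last by move=> a _; rewrite big_filter.
(* The covering hypothesis at [g] provides the [k] factors that Hölder's inequality requires. *)
apply: le_trans (holder_count _ _ h_ge0) _.
  by rewrite k_gt0 size_filter s_cov // mem_head.
rewrite !big_filter ler_prod // => L /= Lg.
by rewrite powR_ge0 /= Lg big_updates_cons.
Qed.

(** * Enumerating the configurations with free values on a finite set *)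

Section extension.
Context {G : choiceType} {A : {fset nat}}.

Definition extend (D : {fset G}) (w : {ffun D -> A}) (x : G -> nat) : G -> nat :=
  fun g => if insub g is Some h then val (w h) else x g.

Lemma extend_in (D : {fset G}) (w : {ffun D -> A}) x (h : D) :
  extend w x (val h) = val (w h).
Proof. by rewrite /extend valK. Qed.

Lemma extend_out (D : {fset G}) (w : {ffun D -> A}) x g :
  g \notin D -> extend w x g = x g.
Proof. by move=> gD; rewrite /extend insubN. Qed.

Lemma mem_updates (s : seq G) (x y : G -> nat) :
  y \in updates A s x <->
  (forall g, g \in s -> y g \in A) /\ (forall g, g \notin s -> y g = x g).
Proof.
elim: s y => [|g s IH] y /=.
  rewrite inE; split => [/eqP ->|[_ yx]]; first by [].
  by apply/eqP/funext => g; exact: yx.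
split.
  case/allpairsP => -[a z] /= [aA /IH[zA zx] ->].
  split => h; rewrite inE /update; case: eqP => //= _; first exact: zA.
  exact: zx.
move=> [yA yx]; apply/allpairsP.
(* The tail must agree with [x] off [s], so it forgets [y g] unless [g] recurs in [s]. *)
exists (y g, fun h => if h \in s then y h else x h); split => /=.
- by rewrite yA ?mem_head.
- apply/IH; split => h; last by move/negPf ->.
  by move=> hs; rewrite hs yA // inE hs orbT.
- apply/funext => h; rewrite /update; case: eqP => [->//|/eqP hg].
  by case: ifPn => // hs; rewrite yx // inE negb_or hg.
Qed.

Lemma updates_uniq (s : seq G) (x : G -> nat) : uniq s -> uniq (updates A s x).
Proof.
elim: s => //= g s IH /andP[gs s_uniq].
apply: allpairs_uniq; [exact: fset_uniq|exact: IH|].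
move=> p q /allpairsP[[a y] /= [_ /mem_updates[_ yx] ->]].
move=> /allpairsP[[b z] /= [_ /mem_updates[_ zx] ->]] /= eq_yz.
have eq_at h : update y g a h = update z g b h by rewrite eq_yz.
congr pair; first by have := eq_at g; rewrite /update eqxx.
(* The update hides the tails at [g], but both equal [x g] there because [g] is not in [s]. *)
apply/funext => h; have [->|hg] := eqVneq h g; first by rewrite yx ?zx.
by have := eq_at h; rewrite /update (negPf hg).
Qed.

(** Bridge between the lists of Finner's inequality and the finite functions that index [Zu]. *)
Lemma sum_updates (R : pzSemiRingType) (D : {fset G}) (s : seq G) (x : G -> nat)
    (f : (G -> nat) -> R) :
  uniq s -> s =i D ->
  \sum_(y <- updates A s x) f y = \sum_(w : {ffun D -> A}) f (extend w x).
Proof.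
move=> s_uniq sD; rewrite -(big_map (fun w : {ffun D -> A} => extend w x) predT).
apply: perm_big; apply: uniq_perm; first exact: updates_uniq.
  rewrite map_inj_uniq ?index_enum_uniq // => w w' eq_w.
  by apply/ffunP => h; apply/val_inj; rewrite -!(extend_in _ x) eq_w.
move=> y; apply/idP/mapP => [/mem_updates[yA yx]|[w _ ->]].
  have yA' (h : D) : y (val h) \in A by rewrite yA // sD (valP h).
  exists [ffun h => FSetSub (yA' h)]; first exact: mem_index_enum.
  apply/funext => g; have [gD|gD] := boolP (g \in D).
    by rewrite (extend_in _ _ (FSetSub gD)) ffunE.
  by rewrite extend_out // yx // sD.
apply/mem_updates; split => g; rewrite sD => gD; last exact: extend_out.
by rewrite (extend_in _ _ (FSetSub gD)) (valP (w _)).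
Qed.

End extension.

(** * Partition functions with a boundary condition *)

Section partition_function.
Context {R : realType} {G : groupType}.
Variables (A : {fset nat}) (phi : (G -> nat) -> R).

Definition expsup (F : {fset G}) (S : set (G -> nat)) : \bar R :=
  expeR (ereal_sup [set (birkhoff phi F x)%:E | x in S]).

Lemma expsup_ge0 F S : (0 <= expsup F S)%E.
Proof. exact: expeR_ge0. Qed.

Lemma le_expsup F S x : S x -> ((expR (birkhoff phi F x))%:E <= expsup F S)%E.
Proof.
move=> Sx; rewrite -[leLHS]/(expeR (birkhoff phi F x)%:E) lee_expeR.
by apply: ereal_sup_ubound; exists x.
Qed.

(** Writing [c] as [expeR (lne c)] reduces this to a bound on the supremum itself; [0 <= c] permits
    this and covers an empty [S], where [expsup] is 0. *)
Lemma expsup_le F S c : (0 <= c)%E ->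
  (forall x, S x -> ((expR (birkhoff phi F x))%:E <= c)%E) ->
  (expsup F S <= c)%E.
Proof.
move=> c_ge0 le_c; have cE : expeR (lne c) = c by apply/eqP; rewrite lneK_eq.
rewrite -cE lee_expeR; apply: ge_ereal_sup => _ [x Sx <-].
by rewrite -lee_expeR cE; exact: le_c.
Qed.

Section boundary.
Variables (E : set G) (u : E -> A).

(** Taking [y] total lets one configuration define slices over all the sets [D]. In particular
    [slice fset0 x x] says that [x] lies in A^G and extends [u]. *)
Definition slice (D : {fset G}) (y : G -> nat) : set (G -> nat) :=
  [set x | [/\ full_shift A x, forall h, h \in D -> x h = y h &
               forall g : E, x (val g) = val (u g)]].

Lemma slice_exists : A != fset0 -> exists x, slice fset0 x x.
Proof.
case/fset0Pn => a aA.
pose x g : nat := if insub g is Some h then val (u h) else a.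
exists x; split => // [g|g]; rewrite /x; last by rewrite valK.
by case: insubP => // h _ _; exact: valP.
Qed.

Definition restrict (D : {fset G}) (x : G -> nat) (xA : full_shift A x) :
    {ffun D -> A} := [ffun h : D => FSetSub (xA (val h))].

Lemma ZuE F x : Zu phi u F =
  (\sum_(w : {ffun fset_diff_set F E -> A})
     expsup F (slice (fset_diff_set F E) (extend w x)))%E.
Proof.
apply: eq_bigr => w _; congr (expeR (ereal_sup (image _ _))).
apply/seteqP; split => y /= [yA yw yu]; split => //.
  by move=> h hD; rewrite (extend_in _ _ (FSetSub hD)); exact: yw (FSetSub hD).
by move=> h; rewrite yw ?extend_in // valP.
Qed.

Lemma slice_restrict D x y (xA : full_shift A x) :
  slice fset0 x x -> slice D (extend (restrict D xA) y) x.
Proof.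
case=> _ _ xu; split => // h hD.
by rewrite (extend_in _ _ (FSetSub hD)) ffunE.
Qed.

Lemma sum_slices_le_Zu (D L : {fset G}) x :
  (D `<=` fset_diff_set L E)%fset ->
  (\sum_(v : {ffun D -> A}) expsup L (slice D (extend v x)) <= Zu phi u L)%E.
Proof.
move=> DL; rewrite (ZuE L x).
pose res (w : {ffun fset_diff_set L E -> A}) : {ffun D -> A} :=
  [ffun h => w (fincl DL h)].
(* Group the terms of [Zu] by their restriction to [D], and compare block by block. *)
rewrite [leRHS](partition_big res predT) //=; apply: lee_sum => v _.
apply: expsup_le => [|y [yA yv yu]].
  by rewrite sume_ge0 // => *; exact: expsup_ge0.
(* The term indexed by the restriction of [y] itself already dominates; the others are
   non-negative. *)
rewrite (bigD1 (restrict _ yA)) /=; last first.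
  apply/eqP/ffunP => h; rewrite !ffunE; apply/val_inj => /=.
  by rewrite yv ?extend_in // valP.
rewrite -[leLHS]adde0; apply: leeD; last first.
  by rewrite sume_ge0 // => *; exact: expsup_ge0.
by apply: le_expsup; apply: slice_restrict.
Qed.

Lemma expsup_le_Zu F x : slice fset0 x x ->
  ((expR (birkhoff phi F x))%:E <= Zu phi u F)%E.
Proof.
move=> xu; have [xA _ _] := xu; rewrite (ZuE F x).
rewrite (bigD1 (restrict _ xA)) //= -[leLHS]adde0; apply: leeD.
  by apply: le_expsup; exact: slice_restrict.
by rewrite sume_ge0 // => *; exact: expsup_ge0.
Qed.

(** This makes [expsup] finite whenever [Zu] is, so that the real-valued Finner inequality can be
    applied. *)
Lemma expsup_slice_le_Zu F D x : (expsup F (slice D x) <= Zu phi u F)%E.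
Proof.
apply: expsup_le => [|y [yA _ yu]]; last exact: expsup_le_Zu.
by rewrite sume_ge0 // => *; exact: expeR_ge0.
Qed.

End boundary.

(** * Non-negative potentials and covers *)

Hypothesis phi_ge0 : forall x, full_shift A x -> 0 <= phi x.

Lemma phi_shift_ge0 g x : full_shift A x -> 0 <= phi (Defs.shift g x).
Proof. by move=> xA; apply: phi_ge0 => h; exact: xA. Qed.

Lemma birkhoff_ge0 F x : full_shift A x -> 0 <= birkhoff phi F x.
Proof. by move=> xA; apply: sumr_ge0 => g _; exact: phi_shift_ge0. Qed.

Lemma Zu_ge1 (E : set G) (u : E -> A) F : A != fset0 -> (1 <= Zu phi u F)%E.
Proof.
move=> /(slice_exists u)[x xu]; have [xA _ _] := xu.
apply: le_trans (expsup_le_Zu F xu).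
by rewrite lee_fin -expR0 ler_expR birkhoff_ge0.
Qed.

(** Double counting: dropping the elements of each [L] outside [F] only lowers the right side, and
    each [g] in [F] then occurs at least [k] times. *)
Lemma birkhoff_kcover k F K x : full_shift A x -> kcover k F K ->
  k%:R * birkhoff phi F x <= \sum_(L <- K) birkhoff phi L x.
Proof.
move=> xA [_ F_cov]; have phi_ge0' g := phi_shift_ge0 g xA.
apply: (@le_trans _ _
    (\sum_(L <- K) \sum_(g <- F | g \in L) phi (Defs.shift g x))); last first.
  apply: ler_sum => L _; rewrite -big_filter.
  rewrite (perm_big [seq g <- L | g \in F]) /=.
    by rewrite big_filter [leRHS](bigID (mem F)) /= lerDl sumr_ge0.
  apply: uniq_perm; rewrite ?filter_uniq ?fset_uniq // => g.
  by rewrite !mem_filter andbC.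
rewrite (exchange_big_dep predT) //= mulr_sumr big_seq [leRHS]big_seq.
apply: ler_sum => g gF; rewrite big_const_seq iter_addr_0 -[leRHS]mulr_natl.
by rewrite ler_wpM2r // ler_nat F_cov.
Qed.

Lemma Zu_kcover_fin (E : set G) (u : E -> A) F k K : A != fset0 ->
  (0 < k)%N -> kcover k F K -> (forall L, L \in K -> (Zu phi u L < +oo)%E) ->
  (Zu phi u F <= \prod_(L <- K) poweR (Zu phi u L) k%:R^-1)%E.
Proof.
move=> A_neq0 k_gt0 F_cov Z_fin; have [x xu] := slice_exists u A_neq0.
have ki_ge0 : 0 <= k%:R^-1 :> R by rewrite invr_ge0.
have Z_ge0 L : (0 <= Zu phi u L)%E by rewrite (le_trans _ (Zu_ge1 u L A_neq0)).
pose D := fset_diff_set F E.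
pose f L y := fine (expsup L (slice u (D `&` L)%fset y)).
have f_ge0 L y : 0 <= f L y by rewrite fine_ge0 // expsup_ge0.
have fE L y : L \in K -> (f L y)%:E = expsup L (slice u (D `&` L)%fset y).
  move=> LK; rewrite fineK // ge0_fin_numE ?expsup_ge0 //.
  exact: le_lt_trans (expsup_slice_le_Zu _ _ _ _) (Z_fin _ LK).
have f_dep L : depends_on (fun g : G => g \in L) (f L).
  move=> y z yz; congr (fine (expsup L _)).
  have yzD h : h \in (D `&` L)%fset -> y h = z h by rewrite inE => /andP[_ /yz].
  by apply/seteqP; split => v /= [vA vy vu]; split => // h hD; rewrite vy ?yzD.
have f_sum L : L \in K ->
    ((\sum_(y <- updates A [seq g <- D | g \in L] x) f L y)%:E <= Zu phi u L)%E.
  move=> LK; rewrite (@sum_updates _ _ _ (D `&` L)%fset); last 2 first.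
  - by rewrite filter_uniq // fset_uniq.
  - by move=> g; rewrite mem_filter in_fsetI andbC.
  rewrite -sumEFin; under eq_bigr do rewrite fE //.
  apply: sum_slices_le_Zu; apply/fsubsetP => g.
  by rewrite !inE => /andP[/andP[_ gE] gL]; rewrite gL.
apply: (@le_trans _ _
    (\sum_(y <- updates A D x) \prod_(L <- K) f L y `^ k%:R^-1)%:E).
  rewrite (ZuE _ _ x) (@sum_updates _ _ _ D) ?fset_uniq // -sumEFin.
  apply: lee_sum => w _; apply: expsup_le => [|y [yA yw yu]].
    by rewrite lee_fin prodr_ge0 // => L _; exact: powR_ge0.
  rewrite lee_fin; apply: (@le_trans _ _
      (\prod_(L <- K) expR (birkhoff phi L y) `^ k%:R^-1)).
    rewrite (eq_bigr (fun L => expR (birkhoff phi L y / k%:R))) => [|L _].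
      rewrite -expR_sum ler_expR -mulr_suml ler_pdivlMr ?ltr0n // mulrC.
      exact: birkhoff_kcover.
    by rewrite expRM.
  (* The same [y] competes in each supremum [f L], since it agrees with [extend w x] on all of
     [D]. *)
  rewrite [leLHS]big_seq [leRHS]big_seq; apply: ler_prod => L LK.
  rewrite powR_ge0 /= ge0_ler_powR ?nnegrE ?expR_ge0 //.
  rewrite -lee_fin fE //; apply: le_expsup; split => // h.
  by rewrite inE => /andP[hD _]; exact: yw.
apply: (@le_trans _ _ (\prod_(L <- K)
    (\sum_(y <- updates A [seq g <- D | g \in L] x) f L y) `^ k%:R^-1)%:E).
  rewrite lee_fin; apply: (@finner _ _ _ _ A K k (fun L g => g \in L) f) => // g.
  by rewrite inE => /andP[gF _]; apply: F_cov.2.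
rewrite (eq_big_seq (fun L => (fine (Zu phi u L) `^ k%:R^-1)%:E)) => [|L LK].
  rewrite prodEFin lee_fin [leLHS]big_seq [leRHS]big_seq.
  apply: ler_prod => L LK; rewrite powR_ge0 /= ge0_ler_powR ?nnegrE ?fine_ge0 //.
    by rewrite sumr_ge0.
  by rewrite -lee_fin fineK ?f_sum // ge0_fin_numE ?Z_fin.
by rewrite -poweR_EFin fineK // ge0_fin_numE ?Z_fin.
Qed.

End partition_function.

(** * Products and logarithms in the extended reals *)

Lemma prode_gt0 (R : realType) (T : Type) (s : seq T) (f : T -> \bar R) :
  (forall i, 0 < f i)%E -> (0 < \prod_(i <- s) f i)%E.
Proof.
move=> f_gt0; elim: s => [|i s IH]; first by rewrite big_nil lte01.
by rewrite big_cons mule_gt0.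
Qed.

(** Positivity of the factors excludes the product of 0 and [+oo], which is 0 by convention. *)
Lemma prode_pinfty (R : realType) (T : eqType) (s : seq T) (f : T -> \bar R) i :
  (forall j, 0 < f j)%E -> i \in s -> f i = +oo%E -> (\prod_(j <- s) f j = +oo)%E.
Proof.
by move=> f_gt0 i_s fi; rewrite (big_rem i i_s) /= fi gt0_mulye // prode_gt0.
Qed.

Lemma lne_poweR (R : realType) (x : \bar R) (r : R) : (0 < x)%E -> 0 < r ->
  lne (poweR x r) = (r%:E * lne x)%E.
Proof.
case: x => [x| |] // x_gt0 r_gt0; last first.
  by rewrite poweRyr ?gt_eqF //= gt0_muley ?lte_fin.
by rewrite poweR_EFin !lne_EFin ?powR_gt0 // ln_powR.
Qed.

Lemma lne_prod (R : realType) (T : Type) (s : seq T) (f : T -> \bar R) :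
  (forall i, 0 < f i)%E ->
  lne (\prod_(i <- s) f i)%E = (\sum_(i <- s) lne (f i))%E.
Proof.
move=> f_gt0; elim: s => [|i s IH]; first by rewrite !big_nil lne1.
by rewrite !big_cons lneM ?IH // in_itv /= leey andbT ?f_gt0 ?prode_gt0.
Qed.

Theorem lemma3p3 (R : realType) (G : groupType)
    (Gcountable : countable [set: G]) (Gamenable : amenable R G)
    (phi : (G -> nat) -> R) (A : {fset nat}) (A_neq0 : A != fset0)
    (phi_ge0 : forall x : G -> nat, full_shift A x -> 0 <= phi x) :
  (forall (E : set G) (u : E -> A) (F : {fset G}) (k : nat)
      (K : seq {fset G}),
      F != fset0 -> (1 <= k)%N -> kcover k F K ->
      (Zu phi u F <= \prod_(L <- K) poweR (Zu phi u L) (k%:R^-1))%E)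
  /\ shearer (fun F : {fset G} => lne (Z A phi F)).
Proof.
have Z_gt0 (E : set G) (u : E -> A) F : (0 < Zu phi u F)%E.
  by apply: lt_le_trans (Zu_ge1 phi_ge0 u F A_neq0); rewrite lte01.
have Zu_kcover (E : set G) (u : E -> A) F k K : (1 <= k)%N -> kcover k F K ->
    (Zu phi u F <= \prod_(L <- K) poweR (Zu phi u L) k%:R^-1)%E.
  move=> k_gt0 F_cov.
  (* If some [Zu phi u L] is infinite, so is the right side; otherwise the finite case applies. *)
  have [/hasP[L LK /eqP ZL]|/hasPn Z_fin] :=
    boolP (has (fun L => Zu phi u L == +oo%E) K); last first.
    apply: (Zu_kcover_fin phi_ge0) => // L /Z_fin; rewrite ltey.
    exact.
  rewrite (@prode_pinfty _ _ _ _ L) ?leey // => [M|]; first exact: poweR_gt0.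
  by rewrite ZL poweRyr // invr_eq0 pnatr_eq0 -lt0n.
split=> [E u F k K _|F k K _ k_gt0 F_cov]; first exact: Zu_kcover.
have ki_gt0 : 0 < k%:R^-1 :> R by rewrite invr_gt0 ltr0n.
(* Shearer's inequality is the logarithm of the bound for empty [E]. *)
have := Zu_kcover _ (@u_empty G A) _ _ _ k_gt0 F_cov.
have P_gt0 L : (0 < poweR (Zu phi (@u_empty G A) L) k%:R^-1)%E.
  exact: poweR_gt0.
rewrite -lee_lne ?in_itv /= ?leey ?andbT ?(ltW (Z_gt0 _ _ _)) //; last first.
  by rewrite ltW // prode_gt0.
rewrite lne_prod //.
rewrite [leRHS](eq_bigr (fun L => k%:R^-1%:E * lne (Z A phi L)))%E; last first.
  by move=> L _; rewrite lne_poweR.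
(* Distributivity in the extended reals uses that the logarithms are non-negative, that is, [Z] is
   at least 1. *)
rewrite -ge0_sume_distrr // => L _.
by rewrite lne_ge0; exact: Zu_ge1.
Qed.
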